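(* Let $n \ge 2$, and let $\mathbf{w} \in \mathbb{Q}^n$ be a nontrivial weighting vector (i.e., $\mathbf{w} \nsim \mathbf{1}$). The map $T_{\mathbf{w}}$ is recoverable from the pairs map $P$ if and only if $\mathbf{w}$ or $-\mathbf{w}$ is equivalent to the Borda count weighting vector $[n-1, n-2, \dots, 2, 1, 0]^t$.
   Context: Let $M^{(1,\dots,1)}$ be the $\mathbb{Q}$-vector space with basis the full rankings of the candidates $1,\dots,n$ (i.e. all orderings of $\{1,\dots,n\}$ from first place to last place). For a weighting vector $\mathbf{w} = [w_1,\dots,w_n]^t \in \mathbb{Q}^n$, the positional voting map $T_{\mathbf{w}}: M^{(1,\dots,1)} \to \mathbb{Q}^n$ is the linear map sending a full ranking to the vector whose $i$th coordinate is $w_j$, where $j$ is the position of candidate $i$ in that ranking. Let $M^{(1,1,n-2)}$ be the $\mathbb{Q}$-vector space with basis the tabloids of shape $(1,1,n-2)$, which are identified with the ordered pairs $(i,j)$ of distinct candidates (first row $i$, second row $j$, all other candidates in the third row). The pairs map $P: M^{(1,\dots,1)} \to M^{(1,1,n-2)}$ is the linear map sending each full ranking to the sum of all ordered pairs $(i,j)$ such that $i$ is ranked above $j$ in that ranking. For linear maps $T: V \to W$ and $T': V \to U$ on the same vector space $V$, $T'$ is recoverable from $T$ if there exists a linear map $R: W \to U$ with $T' = R \circ T$. $\mathbf{1}$ denotes the all-ones vector in $\mathbb{Q}^n$. Weighting vectors $\mathbf{w},\mathbf{x} \in \mathbb{Q}^n$ are equivalent, written $\mathbf{w} \sim \mathbf{x}$,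 if there exist $\alpha,\beta \in \mathbb{Q}$ with $\alpha > 0$ and $\mathbf{x} = \alpha\mathbf{w} + \beta\mathbf{1}$. By convention, $\mathbf{w} \nsim \mathbf{1}$ amounts to saying that $\mathbf{w}$ is not a scalar multiple (including zero) of $\mathbf{1}$. *)

(* Defs.v *)
From HB Require Import structures.
From mathcomp Require Import all_boot all_order all_algebra all_fingroup.

Set Implicit Arguments.
Unset Strict Implicit.
Unset Printing Implicit Defensive.

Import Order.TTheory GRing.Theory Num.Theory.
Local Open Scope ring_scope.

(* The Q-vector space with basis the finite type B: the formal combination    *)
(* v stands for \sum_b v b *: ket b.                                          *)
Notation freeQ B := {ffun B -> rat^o}.

Definition ket (B : finType) (b : B) : freeQ B := [ffun c => (c == b)%:R].

Definition linext (B : finType) (V : lmodType rat) (f : B -> V)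
  (v : freeQ B) : V := \sum_(b : B) (v b : rat) *: f b.

Lemma linext_is_linear (B : finType) (V : lmodType rat) (f : B -> V) :
  linear (linext f).
Proof.
move=> a u v; rewrite /linext scaler_sumr -big_split /=.
by apply: eq_bigr => b _; rewrite !ffunE scalerDl scalerA.
Qed.

HB.instance Definition _ (B : finType) (V : lmodType rat) (f : B -> V) :=
  GRing.isLinear.Build rat (freeQ B) V _ (linext f) (linext_is_linear f).

Lemma linext_ket (B : finType) (V : lmodType rat) (f : B -> V) (b : B) :
  linext f (ket b) = f b.
Proof.
rewrite /linext (bigD1 b) //= ffunE eqxx scale1r big1 ?addr0 // => c /negPf cb.
by rewrite ffunE cb scale0r.
Qed.

(* Candidates and positions are both numbered from 0 (position 0 is first     *)
(* place); a full ranking r sends each candidate i to its position r i.       *)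
Notation ranking n := {perm 'I_n}.

(* Tabloids of shape (1, 1, n - 2): ordered pairs of distinct candidates. *)
Notation cand_pair n := {p : 'I_n * 'I_n | p.1 != p.2}.

Definition positional_map (n : nat) (w : 'cV[rat]_n) :
    {linear freeQ (ranking n) -> 'cV[rat]_n} :=
  linext (fun r : ranking n => \col_(i < n) w (r i) 0).

Definition pairs_map (n : nat) :
    {linear freeQ (ranking n) -> freeQ (cand_pair n)} :=
  linext (fun r : ranking n =>
    \sum_(p : cand_pair n | (r (val p).1 < r (val p).2)%N) ket p).

Definition recoverable (V W U : lmodType rat)
    (T' : {linear V -> U}) (T : {linear V -> W}) : Prop :=
  exists R : {linear W -> U}, forall v : V, T' v = R (T v).

Definition ones (n : nat) : 'cV[rat]_n := const_mx 1.

Definition weight_equiv (n : nat) (w x : 'cV[rat]_n) : Prop :=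
  exists alpha beta : rat, 0 < alpha /\ x = alpha *: w + beta *: ones n.

Definition nontrivial (n : nat) (w : 'cV[rat]_n) : Prop :=
  ~ weight_equiv w (ones n).

(* Weight equivalence to the all-ones vector already includes w = 0. *)
Lemma weight_equiv_onesP (n : nat) (w : 'cV[rat]_n) :
  weight_equiv w (ones n) <-> exists c : rat, w = c *: ones n.
Proof.
split=> [[a [b [a_gt0 def1]]] | [c ->]]; last first.
  exists 1, (1 - c); split=> //.
  by rewrite scale1r -scalerDl addrC subrK scale1r.
exists (a^-1 * (1 - b)); rewrite -scalerA scalerBl scale1r {1}def1 addrK.
by rewrite scalerA mulVf ?scale1r // gt_eqF.
Qed.

Definition borda (n : nat) : 'cV[rat]_n := \col_(j < n) (n.-1 - j)%N%:R.

(* Main.v *)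
Require Import Defs.
From mathcomp Require Import all_boot all_order all_algebra all_fingroup.
From mathcomp Require Import zify ring lra.

Set Implicit Arguments.
Unset Strict Implicit.
Unset Printing Implicit Defensive.

Import Order.TTheory GRing.Theory Num.Theory.
Local Open Scope ring_scope.

(** Everything rests on what the pairs map forgets. Take a ranking that places
    candidates a and b in consecutive positions k and k + 1, and exchange the
    two. The only pairwise comparison that changes is the one between a and b,
    so the pairs map changes by the fixed vector (a,b) - (b,a), wherever the
    exchange took place ([pairs_map_adjacent_swap]). The score of a, on the
    other hand, changes by w_k - w_(k+1). If the scores are a linear function
    of the pairwise data, this difference cannot depend on k, so w is an
    arithmetic progression ([recoverable_arith]), that is, an affine image of
    the Borda vector; its slope is nonzero because w is nontrivial, and the
    sign of the slope decides between w and -w.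

    Conversely, the Borda score of a candidate is the number of candidates
    ranked below it, and the constant n - 1 is the number ranked below plus the
    number ranked above. Both numbers are sums over the pairs of the ranking,
    so every affine image of the Borda vector is recoverable
    ([borda_affine_recoverable]). *)

(** * Weighting vectors equivalent to the Borda count *)

(** The sign of the slope is what separates the two alternatives. *)
Lemma weight_equiv_signP (n : nat) (w x : 'cV[rat]_n) :
  weight_equiv w x \/ weight_equiv (- w) x <->
  exists alpha beta : rat, alpha != 0 /\ w = alpha *: x + beta *: ones n.
Proof.
split.
  suff affine (c : rat) (b : rat) : c != 0 -> x = c *: w + b *: ones n ->
      exists alpha beta, alpha != 0 /\ w = alpha *: x + beta *: ones n.
    case=> [] [c [b [c_gt0 def_x]]].
      by apply: (affine c b) => //; rewrite gt_eqF.
    apply: (affine (- c) b); first by rewrite oppr_eq0 gt_eqF.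
    by rewrite scaleNr -scalerN.
  move=> c_neq0 ->; exists c^-1, (- (c^-1 * b)).
  rewrite invr_neq0 //; split=> //.
  by rewrite scalerDr !scalerA mulVf // scale1r scaleNr addrK.
move=> [c [b [c_neq0 ->]]].
have unscale : x = c^-1 *: (c *: x + b *: ones n) + - (c^-1 * b) *: ones n.
  by rewrite scalerDr !scalerA mulVf // scale1r scaleNr addrK.
case: (ltrgtP c 0) c_neq0 => // c_sgn _.
  right; exists (- c^-1), (- (c^-1 * b)).
  by rewrite oppr_gt0 invr_lt0 scalerN scaleNr opprK.
by left; exists c^-1, (- (c^-1 * b)); rewrite invr_gt0.
Qed.

(** * Recovering affine images of the Borda count *)

Lemma sum_cand_pair (n : nat) (V : nmodType) (r : ranking n)
    (F : 'I_n * 'I_n -> V) :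
  \sum_(p : cand_pair n | (r (val p).1 < r (val p).2)%N) F (val p) =
  \sum_(p : 'I_n * 'I_n | (r p.1 < r p.2)%N) F p.
Proof.
rewrite [RHS](reindex_omap (val : cand_pair n -> _) insub) /=; last first.
  move=> [i j] /= lt_ij; rewrite insubT //=.
  by apply: contraTneq lt_ij => ->; rewrite ltnn.
by apply: eq_bigl => p; rewrite valK eqxx andbT.
Qed.

Lemma card_rank (n : nat) (r : ranking n) (A : pred 'I_n) :
  (\sum_(j | A (r j)) 1 = \sum_(j | A j) 1)%N.
Proof. by rewrite [RHS](reindex_inj (@perm_inj _ r)). Qed.

Lemma card_ord_below (n : nat) (k : 'I_n) :
  (\sum_(j < n | (j < k)%N) 1 = k)%N.
Proof.
rewrite -(big_ord_widen n (fun=> 1%N)) ?(ltnW (ltn_ord k)) //.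
by rewrite sum1_card card_ord.
Qed.

Lemma card_ranked_above (n : nat) (r : ranking n) (i : 'I_n) :
  (\sum_(j < n | (r j < r i)%N) 1 = r i)%N.
Proof. by rewrite (card_rank r (fun j => j < r i)%N) card_ord_below. Qed.

Lemma card_ranked_below (n : nat) (r : ranking n) (i : 'I_n) :
  (\sum_(j < n | (r i < r j)%N) 1 = n.-1 - r i)%N.
Proof.
rewrite (card_rank r (fun j => r i < j)%N).
have := card_ord n; rewrite -sum1_card (bigID (fun j : 'I_n => r i < j)%N) /=.
rewrite [X in (_ + X)%N](bigD1 (r i)) ?ltnn //=.
rewrite [X in (_ + (_ + X))%N](eq_bigl (fun j : 'I_n => j < r i)%N); last first.
  by move=> j; rewrite -leqNgt ltn_neqAle andbC.
by rewrite card_ord_below; lia.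
Qed.

(** A pair (i,j) contributes alpha to i for its win, and beta / (n - 1) to each
    of i and j; since every candidate occurs in n - 1 of the pairs of a ranking,
    these shares add up to the constant beta. *)
Definition pair_scores (n : nat) (alpha beta : rat) (p : 'I_n * 'I_n) :
    'cV[rat]_n :=
  \col_(i < n) (alpha * (p.1 == i)%:R
                + beta / n.-1%:R * ((p.1 == i)%:R + (p.2 == i)%:R)).

Lemma sum_pairs_first (n : nat) (r : ranking n) (i : 'I_n) :
  \sum_(p : 'I_n * 'I_n | (r p.1 < r p.2)%N) (p.1 == i)%:R =
  (n.-1 - r i)%N%:R :> rat.
Proof.
rewrite -(pair_big_dep xpredT (fun a b => r a < r b)%N
  (fun a b => (a == i)%:R)) /=.
rewrite (bigD1 i) //= [X in _ + X]big1 => [|a /negPf->]; last exact: big1.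
by rewrite addr0 eqxx -card_ranked_below natr_sum.
Qed.

Lemma sum_pairs_second (n : nat) (r : ranking n) (i : 'I_n) :
  \sum_(p : 'I_n * 'I_n | (r p.1 < r p.2)%N) (p.2 == i)%:R = (r i)%:R :> rat.
Proof.
rewrite -(pair_big_dep xpredT (fun a b => r a < r b)%N
  (fun a b => (b == i)%:R)) /= (exchange_big_dep xpredT) //=.
rewrite (bigD1 i) //= [X in _ + X]big1 => [|a /negPf->]; last exact: big1.
by rewrite addr0 eqxx -[in RHS](card_ranked_above r i) natr_sum.
Qed.

Lemma linear_ketE (B : finType) (V : lmodType rat) (T : {linear freeQ B -> V})
    (v : freeQ B) :
  T v = \sum_b (v b : rat) *: T (ket b).
Proof.
have {1}-> : v = \sum_b (v b : rat) *: ket b.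
  apply/ffunP => c; rewrite sum_ffunE (bigD1 c) //= !ffunE eqxx.
  rewrite big1 ?addr0 => [|b /negPf cb]; first exact/esym/mulr1.
  by rewrite !ffunE eq_sym cb; apply: mulr0.
by rewrite linear_sum; apply: eq_bigr => b _; rewrite linearZ.
Qed.

Lemma borda_affine_recoverable (n : nat) (alpha beta : rat) : (2 <= n)%N ->
  recoverable (positional_map (alpha *: borda n + beta *: ones n))
    (pairs_map n).
Proof.
move=> n_ge2.
exists (linext (fun p : cand_pair n => pair_scores alpha beta (val p))) => v.
rewrite linear_ketE (linear_ketE (pairs_map n)) linear_sum.
apply: eq_bigr => r _; rewrite linearZ; congr (_ *: _).
rewrite /= !linext_ket linear_sum /=; under eq_bigr do rewrite linext_ket.
rewrite (sum_cand_pair r (pair_scores alpha beta)).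
apply/colP => i; rewrite summxE !mxE; under eq_bigr do rewrite mxE.
rewrite big_split -!mulr_sumr big_split /= sum_pairs_first sum_pairs_second.
rewrite -natrD subnK; last by have := ltn_ord (r i); lia.
by rewrite mulfVK ?mulr1 // pnatr_eq0; lia.
Qed.

(** * Adjacent exchanges *)

Lemma positional_map_ketE (n : nat) (w : 'cV[rat]_n) (r : ranking n)
    (i : 'I_n) :
  positional_map w (ket r) i 0 = w (r i) 0.
Proof. by rewrite /= linext_ket mxE. Qed.

Lemma pairs_map_ketE (n : nat) (r : ranking n) (p : cand_pair n) :
  pairs_map n (ket r) p = (r (val p).1 < r (val p).2)%N%:R.
Proof.
rewrite /= linext_ket sum_ffunE big_mkcond (bigD1 p) //= ffunE eqxx.
rewrite big1 ?addr0 => [|q /negPf qp]; first by case: ifP.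
by rewrite ffunE eq_sym qp if_same.
Qed.

(** No candidate other than a and b is placed at or between two consecutive
    positions held by a and b, so every comparison involving a third candidate
    survives the exchange. *)
Lemma pairs_map_adjacent_swap (n : nat) (r : ranking n) (a b : 'I_n)
    (p : cand_pair n) : r b = (r a).+1 :> nat ->
  (pairs_map n (ket r) - pairs_map n (ket (tperm a b * r)%g)) p =
  (val p == (a, b))%:R - (val p == (b, a))%:R.
Proof.
move=> rb; rewrite !ffunE !pairs_map_ketE !permM.
case: p => [[i j] /= neq_ij]; rewrite !xpair_eqE.
have rank_neq x y : x <> y -> r x <> r y :> nat.
  by move=> xy eq_r; apply: xy; apply/(@perm_inj _ r)/val_inj.
have third c : c <> a -> c <> b ->
    ((r a < r c) = (r b < r c))%N * ((r c < r a) = (r c < r b))%N.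
  by move=> /rank_neq ca /rank_neq cb; split; lia.
have neq_ab : (a == b) = false by apply/negP => /eqP ab; rewrite ab in rb; lia.
have neq_ba : (b == a) = false by rewrite eq_sym.
have [gt_ba ngt_ab] : (r a < r b)%N /\ (r b < r a)%N = false by split; lia.
case: tpermP neq_ij => [->|->|/[dup] /eqP/negPf-> ia /[dup] /eqP/negPf-> ib];
  case: tpermP => [->|->|/[dup] /eqP/negPf-> ja /[dup] /eqP/negPf-> jb];
  rewrite ?eqxx ?neq_ab ?neq_ba ?gt_ba ?ngt_ab //= ?subr0 => _;
  by rewrite ?(third i ia ib) ?(third j ja jb) subrr.
Qed.

(** Two transpositions suffice: the first sends a to k, and the second sends
    the image of b to l while fixing k, which is neither l nor that image. *)
Lemma ranking_placing (n : nat) (a b k l : 'I_n) : a != b -> k != l ->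
  exists r : ranking n, r a = k /\ r b = l.
Proof.
move=> neq_ab neq_kl; exists (tperm a k * tperm (tperm a k b) l)%g.
rewrite !permM !tpermL (@tpermD _ _ _ k) ?[l == k]eq_sym //.
by rewrite -[X in _ != X](tpermL a k) (inj_eq perm_inj) eq_sym.
Qed.

(** Exchanging two fixed candidates at positions k and k + 1, or at l and l + 1,
    has the same effect on the pairwise data, so the score of the first of them
    must change by the same amount in both cases. *)
Lemma recoverable_const_gap (n : nat) (w : 'cV[rat]_n) (k k' l l' : 'I_n) :
    recoverable (positional_map w) (pairs_map n) ->
    k' = k.+1 :> nat -> l' = l.+1 :> nat ->
  w k 0 - w k' 0 = w l 0 - w l' 0.
Proof.
case: n => [|[|n]] in w k k' l l' *; first by case: k.
  by rewrite (ord1 k) (ord1 k').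
move=> [R def_T] def_k' def_l'.
have gap (m m' : 'I_n.+2) : m' = m.+1 :> nat -> exists r s : ranking n.+2,
    [/\ w m 0 - w m' 0 = R (pairs_map _ (ket r) - pairs_map _ (ket s)) ord0 0
      & forall p, (pairs_map _ (ket r) - pairs_map _ (ket s)) p =
           (val p == (ord0, ord_max))%:R - (val p == (ord_max, ord0))%:R].
  move=> def_m'; have neq_m : m != m' by rewrite -val_eqE /= def_m'; lia.
  have [r [ra rb]] := @ranking_placing _ ord0 ord_max m m' isT neq_m.
  exists r, (tperm ord0 ord_max * r)%g; split=> [|p]; last first.
    by rewrite pairs_map_adjacent_swap // ra rb.
  rewrite linearB -!def_T [RHS]mxE [X in _ = _ + X]mxE !positional_map_ketE.
  by rewrite permM tpermL ra rb.
have [r [s [-> rsE]]] := gap _ _ def_k'.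
have [r1 [s1 [-> rsE1]]] := gap _ _ def_l'.
by congr (R _ _ _); apply/ffunP => p; rewrite rsE rsE1.
Qed.

Lemma recoverable_arith (n : nat) (w : 'cV[rat]_n) : (2 <= n)%N ->
    recoverable (positional_map w) (pairs_map n) ->
  exists alpha beta : rat, w = alpha *: borda n + beta *: ones n.
Proof.
case: n w => [|[|n]] // w _ rec_w.
pose o1 : 'I_n.+2 := lift ord0 ord0.
pose d := w ord0 0 - w o1 0.
have arith (k : nat) (k_lt : (k < n.+2)%N) :
    w (Ordinal k_lt) 0 = w ord0 0 - k%:R * d.
  elim: k k_lt => [|k IHk] k_lt.
    by rewrite mul0r subr0; congr (w _ _); apply: val_inj.
  have := @recoverable_const_gap _ _ (Ordinal (ltnW k_lt)) (Ordinal k_lt)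
    ord0 o1 rec_w erefl erefl.
  rewrite IHk -/d => gap_k; rewrite -natr1; lra.
exists d, (w ord0 0 - n.+1%:R * d); apply/colP => k; rewrite !mxE.
case: k => k k_lt; rewrite arith natrB //=; ring.
Qed.

Theorem theorem6 (n : nat) (hn : (2 <= n)%N) (w : 'cV[rat]_n)
    (hw : nontrivial w) :
  recoverable (positional_map w) (pairs_map n) <->
  weight_equiv w (borda n) \/ weight_equiv (- w) (borda n).
Proof.
rewrite weight_equiv_signP; split=> [rec_w | [c [b [_ ->]]]]; last first.
  exact: borda_affine_recoverable.
have [c [b def_w]] := recoverable_arith hn rec_w.
exists c, b; split=> //; apply: contra_notN hw => /eqP c0.
by apply/weight_equiv_onesP; exists b; rewrite def_w c0 scale0r add0r.
Qed.
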